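(* Let $p$ be a prime. The distance Laplacian characteristic polynomial of the power graph $\mathcal{P}(\mathbb{Z}_{p}\times \mathbb{Z}_{p} \times \mathbb{Z}_{p})$ is, up to the sign $(-1)^{p^3}$, \[ x(x-p^{3})(x-2p^{3}+1)^{p^{2}+p}(x-2p^{3}+p)^{p^{3}-p^{2}-p-2}; \] equivalently, $\det(xI-D^L)$ equals this polynomial, where $D^L$ is the distance Laplacian matrix of this power graph.
   Context: $\mathbb{Z}_m$ denotes the cyclic group of integers modulo $m$. The (undirected) power graph $\mathcal{P}(\mathcal{G})$ of a finite group $\mathcal{G}$ has vertex set $\mathcal{G}$, and two distinct elements $x,y$ are adjacent iff $y=x^{i}$ or $x=y^{j}$ for some positive integers $i,j$. For a connected graph $G$ with vertices $v_1,\dots,v_n$, $D(G)=(d(v_i,v_j))$ is the distance matrix, $Tr(v_i)=\sum_j d(v_i,v_j)$ is the transmission of $v_i$, $Tr(G)=\mathrm{diag}(Tr(v_1),\dots,Tr(v_n))$, and the distance Laplacian matrix is $D^L(G)=Tr(G)-D(G)$. The paper defines the distance Laplacian characteristic polynomial as $\det(D^L(G)-xI_n)$. *)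

(* Defs.v *)
From HB Require Import structures.
From mathcomp Require Import all_boot all_order all_fingroup all_algebra.
From mathcomp Require Import boolp.

Set Implicit Arguments.
Unset Strict Implicit.
Unset Printing Implicit Defensive.

Import GRing.Theory.
Local Open Scope ring_scope.

(** A finite simple graph is given by its adjacency relation on a finType. *)

Definition power_graph (gT : finGroupType) : rel gT := fun x y =>
  `[< x <> y /\
      ((exists2 i : nat, (0 < i)%N & y = (x ^+ i)%g) \/
       (exists2 j : nat, (0 < j)%N & x = (y ^+ j)%g)) >].

Definition has_walk (T : finType) (e : rel T) (x y : T) (k : nat) : bool :=
  [exists s : k.-tuple T, path e x s && (last x s == y)].

(** The default value 0 is only taken when no walk joins [x] to [y]; by
    [connect_power_graph] below this never happens in a power graph. *)
Definition graph_dist (T : finType) (e : rel T) (x y : T) : nat :=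
  if pselect (exists k, has_walk e x y k) is left ex then ex_minn ex else 0%N.

Definition transmission (T : finType) (e : rel T) (x : T) : nat :=
  (\sum_(y : T) graph_dist e x y)%N.

(** Matrices indexed by the vertices, in the order of [enum T]. *)

Definition dist_mx (T : finType) (e : rel T) : 'M[int]_#|T| :=
  \matrix_(i, j) (graph_dist e (enum_val i) (enum_val j))%:R.

Definition transmission_mx (T : finType) (e : rel T) : 'M[int]_#|T| :=
  diag_mx (\row_i (transmission e (enum_val i))%:R).

Definition dist_laplacian (T : finType) (e : rel T) : 'M[int]_#|T| :=
  transmission_mx e - dist_mx e.

(** [\det (D^L - x I)], which differs from MathComp's monic [char_poly],
    [\det (x I - D^L)], by the sign [(-1) ^+ #|T|]. *)
Definition dist_laplacian_char_poly (T : finType) (e : rel T) : {poly int} :=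
  \det (map_mx polyC (dist_laplacian e) - 'X%:M).

Lemma power_graph_irr (gT : finGroupType) : irreflexive (@power_graph gT).
Proof. by move=> x; apply/asboolP => -[]. Qed.

Lemma power_graph_sym (gT : finGroupType) : symmetric (@power_graph gT).
Proof.
by move=> x y; apply/asboolP/asboolP=> -[ne xy]; split;
  [exact/nesym | case: xy; [right | left] | exact/nesym
  | case: xy; [right | left]].
Qed.

Lemma connect_power_graph (gT : finGroupType) (x y : gT) :
  exists k, has_walk (@power_graph gT) x y k.
Proof.
have to1 z : connect (@power_graph gT) z 1%g.
  have [->|/eqP nz] := eqVneq z 1%g; first exact: connect0.
  apply/connect1/asboolP; split=> //; left.
  by exists #[z]%g; rewrite ?order_gt0 ?expg_order.
have /connectP[s es ys] : connect (@power_graph gT) x y.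
  apply: connect_trans (to1 x) _.
  by rewrite (sym_connect_sym (@power_graph_sym gT)).
by exists (size s); apply/existsP; exists (in_tuple s); rewrite es -ys /=.
Qed.

(* Main.v *)
(* In a group of prime exponent p, two elements are at distance at most 2, and
   off the diagonal xI - D^L depends only on the cyclic subgroups <x> and <y>.
   With a = x - 2N + p it is therefore a I plus a matrix factoring through the
   set of k + 2 cyclic subgroups, and Sylvester's identity
   det(a I_n + U V) a^m = a^n det(a I_m + V U) reduces its determinant to one
   of size k + 2.  That quotient is b I, with b = x - 2N + 1, plus a matrix
   factoring through {trivial, nontrivial}; a second use of the identity leaves
   a 2 x 2 determinant, equal to x (x - N). *)

Require Import Defs.
From HB Require Import structures.
From mathcomp Require Import all_boot all_order all_fingroup all_algebra.
From mathcomp Require Import boolp.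
From mathcomp Require Import cyclic ring zify.

Set Implicit Arguments.
Unset Strict Implicit.
Unset Printing Implicit Defensive.

Import GRing.Theory.
Local Open Scope ring_scope.

(** * Determinants of scalar matrices plus low-rank terms *)

(* Both sides are computed from the block matrix [[a, -U], [V, 1]], whose
   determinant can be found by clearing either off-diagonal block. *)
Lemma det_scalar_add_mulmxC (R : comNzRingType) (m n : nat) (a : R)
    (U : 'M[R]_(n, m)) (V : 'M[R]_(m, n)) :
  \det (a%:M + U *m V) * a ^+ m = a ^+ n * \det (a%:M + V *m U).
Proof.
pose B := block_mx a%:M (- U) V 1%:M.
have <- : \det B = \det (a%:M + U *m V).
  have : B *m block_mx 1%:M 0 (- V) 1%:M = block_mx (a%:M + U *m V) (- U) 0 1%:M.
    by rewrite mulmx_block !mulmx1 !mulmx0 !mul1mx mulmxN mulNmx opprK subrr !add0r.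
  by move/(congr1 determinant); rewrite det_mulmx det_lblock det_ublock !det1 !mulr1.
have : B *m block_mx 1%:M U 0 a%:M = block_mx a%:M 0 V (a%:M + V *m U).
  rewrite mulmx_block !mulmx1 !mulmx0 !mul1mx !addr0 mulNmx.
  by rewrite mul_scalar_mx mul_mx_scalar subrr addrC.
move/(congr1 determinant).
by rewrite det_mulmx det_ublock det_lblock det1 mul1r !det_scalar.
Qed.

(** The matrix factors through the 0/1 incidence matrix [U] of [f]. In the swapped product, columns
    over one fiber are summed, which produces the fiber sizes. *)
Lemma det_scalar_add_quotient (R : comNzRingType) (m n : nat) (a : R)
    (f : 'I_n -> 'I_m) (W : 'I_m -> 'I_m -> R) :
  \det (a%:M + \matrix_(i, j) W (f i) (f j)) * a ^+ m =
  a ^+ n * \det (a%:M + \matrix_(k, l) (W k l *+ #|[set i | f i == l]|)).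
Proof.
pose U : 'M[R]_(n, m) := \matrix_(i, k) (f i == k)%:R.
pose V : 'M[R]_(m, n) := \matrix_(k, j) W k (f j).
have -> : \matrix_(i, j) W (f i) (f j) = U *m V.
  apply/matrixP => i j; rewrite !mxE (bigD1 (f i)) //= !mxE eqxx mul1r.
  by rewrite big1 ?addr0 // => k ne; rewrite !mxE eq_sym (negPf ne) mul0r.
rewrite det_scalar_add_mulmxC; congr (_ * \det (_ + _)).
apply/matrixP => k l; rewrite !mxE -sumr_const [RHS]big_mkcond /=.
by apply: eq_bigr => i _; rewrite !mxE inE; case: eqP => [->|_]; rewrite ?mulr1 ?mulr0.
Qed.

(** * Distances from short walks *)

Section GraphDist.
Variables (T : finType) (e : rel T).

Lemma has_walk0 (x y : T) : has_walk e x y 0 = (x == y).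
Proof.
apply/existsP/idP => [[s]|/eqP ->]; first by rewrite tuple0 /=.
by exists [tuple]; rewrite /= eqxx.
Qed.

Lemma has_walk1 (x y : T) : has_walk e x y 1 = e x y.
Proof.
apply/existsP/idP => [[[[|z [|? ?]] //= ?]]|exy].
  by rewrite andbT => /andP[xz /eqP <-].
by exists [tuple y]; rewrite /= exy eqxx.
Qed.

Lemma graph_dist_eq (x y : T) (d : nat) : has_walk e x y d ->
  (forall k, (k < d)%N -> ~~ has_walk e x y k) -> graph_dist e x y = d.
Proof.
move=> xyd low; rewrite /graph_dist; case: pselect => [ex|[]]; last by exists d.
case: ex_minnP => k xyk /(_ _ xyd) kd; apply/eqP; rewrite eqn_leq kd leqNgt /=.
by apply/negP => /low; rewrite xyk.
Qed.

End GraphDist.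

(** * Power graphs of groups of prime exponent *)

Section ExponentP.
Variables (gT : finGroupType) (p : nat) (hp : prime p).
Hypothesis xp1 : forall x : gT, (x ^+ p = 1)%g.

Lemma order_exponent_prime (x : gT) : x != 1%g -> #[x]%g = p.
Proof. by move=> nx; apply: nt_prime_order. Qed.

Lemma cycle_eq_exponent_prime (x y : gT) : y != 1%g -> y \in <[x]>%g ->
  <[y]>%g = <[x]>%g.
Proof.
move=> ny yx; apply/eqP; rewrite eqEcard cycle_subG yx /= -!orderE.
rewrite (order_exponent_prime ny); apply: dvdn_leq (prime_gt0 hp) _.
by rewrite order_dvdn xp1.
Qed.

Lemma power_graph_exponent_prime (x y : gT) :
  power_graph x y =
    (x != y) && [|| x == 1, y == 1 | (<[x]> == <[y]>)]%g.
Proof.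
have powP (u v : gT) : (exists2 i : nat, (0 < i)%N & v = (u ^+ i)%g) <->
    v \in <[u]>%g.
  split=> [[i _ ->]|]; first exact: mem_cycle.
  (* Adding the order of [u] makes the exponent positive without changing the power. *)
  case/cycleP=> i ->; exists (i + #[u]%g)%N; first by rewrite addn_gt0 order_gt0 orbT.
  by rewrite expgD expg_order mulg1.
apply/asboolP/idP => [[/eqP -> /= []/powP]|/andP[/eqP nxy]].
- by case: (eqVneq y 1%g) => [|ny /(cycle_eq_exponent_prime ny) ->]; rewrite ?eqxx ?orbT.
- by case: (eqVneq x 1%g) => [|nx /(cycle_eq_exponent_prime nx) ->]; rewrite ?eqxx ?orbT.
move=> h; split=> //; case/or3P: h => /eqP h.
- by right; apply/powP; rewrite h group1.
- by left; apply/powP; rewrite h group1.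
by left; apply/powP; rewrite h cycle_id.
Qed.

(** The identity is adjacent to every other vertex, so a walk through it bounds all distances by
    2. *)
Lemma graph_dist_exponent_prime (x y : gT) :
  graph_dist (@power_graph gT) x y =
  if x == y then 0%N else
  if [|| x == 1, y == 1 | (<[x]> == <[y]>)]%g then 1%N else 2%N.
Proof.
have [<-|nxy] := eqVneq; first by apply: graph_dist_eq => //; rewrite has_walk0.
case: ifPn => h.
  apply: graph_dist_eq => [|[]//]; last by rewrite has_walk0.
  by rewrite has_walk1 power_graph_exponent_prime nxy.
apply: graph_dist_eq => [|[|[|//]] _]; last first.
- by rewrite has_walk1 power_graph_exponent_prime nxy.
- by rewrite has_walk0.
move: h; rewrite !negb_or => /and3P[nx ny _].
apply/existsP; exists [tuple 1%g; y]; rewrite /= !power_graph_exponent_prime.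
by rewrite nx eqxx (eq_sym 1%g) ny !orbT eqxx.
Qed.

Lemma card_cycle_fiber (x : gT) :
  #|[set y : gT | (<[y]> == <[x]>)%g]| = if x == 1%g then 1%N else p.-1.
Proof.
have [->|nx] := eqVneq.
  by rewrite -(cards1 (1%g : gT)); apply: eq_card => y;
    rewrite !inE cycle1 cycle_eq1.
have -> : [set y : gT | (<[y]> == <[x]>)%g] = <[x]>%g :\ 1%g.
  apply/setP => y; rewrite !inE; apply/eqP/andP=> [yx|[]].
    by rewrite -(cycle_eq1 y) yx cycle_eq1 nx -cycle_subG yx.
  exact: cycle_eq_exponent_prime.
have := cardsD1 1%g <[x]>%g; rewrite group1 -orderE (order_exponent_prime nx).
by move=> ->.
Qed.

(** The added term avoids truncated subtraction: it is the total shortfall of the distances from the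
    constant 1 (for the identity) or 2 (otherwise). *)
Lemma transmission_exponent_prime (x : gT) :
  (transmission (@power_graph gT) x + (if x == 1%g then 1 else p.+1) =
    if x == 1%g then #|gT| else 2 * #|gT|)%N.
Proof.
have one z : #|[set y : gT | y == z]| = 1%N.
  by rewrite -(cards1 z); apply: eq_card => y; rewrite !inE.
have count (P : pred gT) : (\sum_(y : gT) P y)%N = #|[set y | P y]|.
  by rewrite -sum1dep_card [RHS]big_mkcond; apply: eq_bigr => y _; case: (P y).
rewrite /transmission; case: ifPn => [/eqP ->|nx].
  have <- : (\sum_(y : gT) (y == 1%g))%N = 1%N by rewrite count one.
  rewrite -big_split -sum1_card; apply: eq_bigr => y _ /=.
  by rewrite graph_dist_exponent_prime eqxx eq_sym; case: eqP.
(* The vertex [x] falls short of 2 by two, so it is counted in the first and third sums; the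
   identity and the other generators of [<[x]>] fall short by one. *)
have -> : p.+1 = ((\sum_(y : gT) (y == x)) + (\sum_(y : gT) (y == 1%g)) +
    \sum_(y : gT) (<[y]> == <[x]>)%g)%N.
  by rewrite !count card_cycle_fiber (negPf nx) !one; have := prime_gt0 hp; lia.
rewrite -!big_split -sum1_card big_distrr; apply: eq_bigr => y _ /=.
rewrite graph_dist_exponent_prime (negPf nx) (eq_sym x) (eq_sym <[x]>%g) /=.
have [->|nyx] := eqVneq y x; first by rewrite (negPf nx) eqxx.
have [->|ny] := eqVneq y 1%g; last by case: eqP.
by rewrite cycle1 eq_sym cycle_eq1 (negPf nx).
Qed.

(** Here [k.+1] is the number of subgroups of order [p]: they partition the nonidentity elements
    into classes of size [p.-1]. *)
Lemma char_poly_dist_laplacian_exponent_prime (k : nat) :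
    #|gT| = (1 + k.+1 * p.-1)%N ->
  char_poly (dist_laplacian (@power_graph gT)) =
    'X * ('X - #|gT|%:R) * ('X - 2 * #|gT|%:R + 1) ^+ k
      * ('X - 2 * #|gT|%:R + p%:R) ^+ (#|gT| - k.+2).
Proof.
move=> cardG.
pose C := [set <[x]>%g | x : gT].
have cC x : <[x]>%g \in C by apply: imset_f.
pose c x := enum_rank_in (cC 1%g) <[x]>%g.
have cK x : enum_val (c x) = <[x]>%g by apply: enum_rankK_in.
have cE x y : (c x == c y) = (<[x]> == <[y]>)%g.
  by rewrite -(inj_eq enum_val_inj) !cK.
have c1E x : (c x == c 1%g) = (x == 1%g) by rewrite cE cycle1 cycle_eq1.
have cP l : exists x, l = c x.
  have /imsetP[x _ lx] := enum_valP l; exists x.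
  by apply: enum_val_inj; rewrite cK.
have fiber l : #|[set i : 'I_#|gT| | c (enum_val i) == l]| =
    if l == c 1%g then 1%N else p.-1.
  have [x ->] := cP l; rewrite c1E -card_cycle_fiber.
  rewrite -[LHS](card_imset _ (@enum_val_inj gT gT)); congr #|pred_of_set _|.
  apply/setP => y; rewrite !inE; apply/imsetP/idP => [[i]|xy].
    by rewrite inE cE => ? ->.
  by exists (enum_rank y); rewrite ?inE ?enum_rankK ?cE.
have cardC : #|C| = k.+2.
  have : (\sum_(l : 'I_#|C|) #|[set i : 'I_#|gT| | c (enum_val i) == l]|)%N = #|gT|.
    transitivity #|{: 'I_#|gT|}|; last exact: card_ord.
    rewrite -[RHS]sum1_card.
    rewrite (partition_big (fun i : 'I_#|gT| => c (enum_val i)) predT) //=.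
    by apply: eq_bigr => l _; rewrite sum1dep_card.
  rewrite (bigD1 (c 1%g)) //= fiber eqxx.
  rewrite (eq_bigr (fun=> p.-1)) => [|l /negPf nl]; last by rewrite fiber nl.
  rewrite sum_nat_const cardC1 card_ord cardG.
  have := prime_gt1 hp; have : (0 < #|C|)%N by apply/card_gt0P; exists <[1]>%g.
  case: #|C| => // n _; case: p => [|[|q]] //= _ [] /eqP.
  by rewrite eqn_pmul2r // => /eqP ->.
set N := #|gT|; set N' : {poly int} := N%:R.
pose a : {poly int} := 'X - 2 * N' + p%:R.
pose b : {poly int} := 'X - 2 * N' + 1.
have p1 : p.-1%:R = p%:R - 1 :> {poly int} by rewrite -subn1 natrB // prime_gt0.
have N1 : N' = 1 + k.+1%:R * (p%:R - 1).
  by rewrite /N' /N cardG natrD natrM p1.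
(* Off the diagonal of the vertex matrix these are distances. The trivial class has a single vertex,
   so its diagonal value is free to absorb the smaller transmission of the identity. *)
pose W (i j : 'I_#|C|) : {poly int} :=
  if i == c 1%g then (if j == c 1%g then N' + 1 - p%:R else 1) else
  if (j == c 1%g) || (i == j) then 1 else 2.
(* Splitting [a] as [b + (p - 1)] makes the quotient matrix in turn a scalar
   plus a function of whether each cyclic subgroup is trivial. *)
pose h (i : 'I_#|C|) : 'I_2 := if i == c 1%g then 0 else 1.
pose W2 (i j : 'I_2) : {poly int} :=
  if i == 0 then (if j == 0 then N' else p%:R - 1) else
  if j == 0 then 1 else 2 * (p%:R - 1).
have quotient1 : char_poly_mx (dist_laplacian (@power_graph gT)) =
    a%:M + \matrix_(i, j) W (c (enum_val i)) (c (enum_val j)).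
  apply/matrixP => i j; rewrite !mxE /W !c1E cE -(inj_eq enum_val_inj).
  set x := enum_val i; set y := enum_val j.
  rewrite graph_dist_exponent_prime /a.
  have [<-|nxy] := eqVneq x y.
    have /(congr1 (fun n => n%:R : {poly int})) := transmission_exponent_prime x.
    rewrite !eqxx orbT !mulr1n subr0 polyC_natr.
    case: ifP => _; rewrite natrD ?natrM => /(canRL (addrK _)) ->.
      by rewrite -/N -/N'; ring.
    by rewrite -/N -/N' -natr1; ring.
  rewrite !mulr0n !sub0r !add0r; case: (x =P 1%g) nxy => [->|_] nxy /=; last first.
    by case: ifP => _; rewrite polyCN opprK polyC_natr.
  by rewrite eq_sym (negPf nxy) polyCN opprK polyC_natr.
(* On a nontrivial diagonal entry, [a + (p - 1) = b + 2 * (p - 1)], which matches the off-diagonal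
   entries between nontrivial classes. *)
have quotient2 :
    a%:M + \matrix_(i, j)
      (W i j *+ #|[set t : 'I_#|gT| | c (enum_val t) == j]|) =
    b%:M + \matrix_(i, j) W2 (h i) (h j).
  apply/matrixP => i j; rewrite !mxE fiber /W /W2 /h /a /b.
  have [<-|nij] := eqVneq i j.
    rewrite orbT !mulr1n; case: ifP => e /=; first by rewrite e mulr1n; ring.
    by rewrite -[_ *+ p.-1]mulr_natr p1; ring.
  rewrite !mulr0n !add0r orbF; case: (i =P c 1%g) nij => [->|_] nij /=.
    by rewrite (eq_sym j) (negPf nij) /= p1.
  by case: ifP => _ /=; rewrite -1?[_ *+ p.-1]mulr_natr ?p1.
have fiber2 (j : 'I_2) : #|[set i | h i == j]| = if j == 0 then 1%N else k.+1.
  have h0 : [set i | h i == 0] = [set c 1%g].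
    by apply/setP => i; rewrite !inE /h; case: ifP.
  have [->|nj] := eqVneq j 0; first by rewrite h0 cards1.
  have -> : [set i | h i == j] = ~: [set c 1%g].
    apply/setP => i; rewrite -h0 !inE; have := nj.
    by case: (h i) => -[|[|//]] ?; case: (j) => -[|[|//]] ?.
  by rewrite cardsC1 card_ord cardC.
have := det_scalar_add_quotient a (fun i : 'I_#|gT| => c (enum_val i)) W.
have := det_scalar_add_quotient b h W2.
rewrite -quotient1 quotient2 -/(char_poly _).
have -> : a ^+ #|C| = a ^+ k.+2 by rewrite cardC.
have -> : b ^+ #|C| = b ^+ k.+2 by rewrite cardC.
have -> : \det (b%:M + \matrix_(i, j) (W2 i j *+ #|[set t | h t == j]|)) =
    'X * ('X - N').
  rewrite (expand_det_row _ 0) !big_ord_recl big_ord0 /cofactor !det_mx11 !mxE /=.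
  (* With [E] the determinant is [('X - N' + 1) * ('X - 1) - (N' - 1)]. *)
  have E : (p%:R - 1) *+ k.+1 = N' - 1 by rewrite N1 -[LHS]mulr_natr; ring.
  rewrite !fiber2 /W2 /b /= -mulrnAr E; ring.
(* Both [a] and [b] are monic of degree one, so their powers can be cancelled. *)
have nz m : 'X - 2 * N' + m%:R != 0 :> {poly int}.
  have <- : 'X - (2 * N%:R - m%:R)%:P = 'X - 2 * N' + m%:R.
    by rewrite polyCB polyCM !polyC_natr; ring.
  by rewrite polyXsubC_eq0.
move=> d2 d1; have {d2}/(mulIf (expf_neq0 2 (nz 1%N))) :
    \det (b%:M + \matrix_(i, j) W2 (h i) (h j)) * b ^+ 2 =
    ('X * ('X - N') * b ^+ k) * b ^+ 2.
  by rewrite d2 -addn2 exprD; ring.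
move=> d2; apply: (mulIf (expf_neq0 k.+2 (nz p))).
have kN : (k.+2 <= N)%N by rewrite /N cardG; have := prime_gt1 hp; nia.
have aN : a ^+ #|gT| = a ^+ (N - k.+2) * a ^+ k.+2 by rewrite -exprD subnK.
by rewrite -/a d1 d2 aN; ring.
Qed.

End ExponentP.

(** * Sign convention and the cube of ['Z_p] *)

Lemma dist_laplacian_char_polyE (T : finType) (e : rel T) :
  dist_laplacian_char_poly e = (-1) ^+ #|T| * char_poly (dist_laplacian e).
Proof. by rewrite /char_poly -detZ scaleN1r opprB. Qed.

Lemma expg_Zp_prime (p : nat) (hp : prime p) (x : 'Z_p) : (x ^+ p = 1)%g.
Proof.
apply: val_inj.
by rewrite Zp_expg /= -[X in (_ * X)%N](Zp_cast (prime_gt1 hp)) modnMl.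
Qed.

Lemma expg_pair (gT1 gT2 : finGroupType) (x : gT1) (y : gT2) (n : nat) :
  ((x, y) ^+ n = (x ^+ n, y ^+ n))%g.
Proof. by elim: n => // n IHn; rewrite !expgS IHn. Qed.

(* The exponent [p ^ 3 - p ^ 2 - p - 2] is never truncated, since [2 <= p]. *)
Theorem theorem2p8 (p : nat) (hp : prime p) :
  let e := @power_graph ('Z_p * 'Z_p * 'Z_p)%type in
  let q : {poly int} :=
    'X * ('X - p%:R ^+ 3)
       * ('X - 2 * p%:R ^+ 3 + 1) ^+ (p ^ 2 + p)%N
       * ('X - 2 * p%:R ^+ 3 + p%:R) ^+ (p ^ 3 - p ^ 2 - p - 2)%N in
  dist_laplacian_char_poly e = (-1) ^+ (p ^ 3)%N * q /\
  char_poly (dist_laplacian e) = q.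
Proof.
move=> e q.
have cardG : #|{: 'Z_p * 'Z_p * 'Z_p}| = (p ^ 3)%N.
  by rewrite !card_prod card_ord (Zp_cast (prime_gt1 hp)) !expnS muln1 mulnA.
have charE : char_poly (dist_laplacian e) = q.
  (* The value of [k] comes from [p ^ 3 - 1 = (p - 1) * (p ^ 2 + p + 1)]. *)
  rewrite (char_poly_dist_laplacian_exponent_prime hp _ (k := p ^ 2 + p)).
  - rewrite cardG natrX; congr (_ * _ ^+ _); lia.
  - by case=> -[x y] z; rewrite !expg_pair !expg_Zp_prime.
  by rewrite cardG; case: p hp {q e cardG} => // n _; rewrite /= !expnS; lia.
by rewrite dist_laplacian_char_polyE charE cardG.
Qed.
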